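(* Let $\gamma,\alpha,\eta,\delta$ be umbrae, let $(s_n(x))_{n\ge0}$ with $s_n(x)=\sum_{k=0}^ns_{n,k}x^k$ be the Sheffer sequence of $(\gamma,\alpha)$ and let $(r_n(x))_{n\ge0}$ be the Sheffer sequence of $(\eta,\delta)$. Then the umbral composition $\bigl(s_n(\mathbf r(x))\bigr)_{n\ge0}$, defined by $s_n(\mathbf r(x))=\sum_{k=0}^ns_{n,k}r_k(x)$, is the Sheffer sequence of \[ \bigl(\gamma+\eta\boldsymbol{\cdot}\beta\boldsymbol{\cdot}\alpha_D,\ \alpha+\delta\boldsymbol{\cdot}\beta\boldsymbol{\cdot}\alpha_D\bigr). \]
   Context: Umbral calculus setting. Fix a finite set $\mathbf{x}$ of commuting variables (containing $x$) and a further variable $z$. To every formal power series $f(z)\in\mathbb{C}[\mathbf{x}][[z]]$ with $f(0)=1$ a symbol (its umbra) is attached. The evaluation $E$ is the $\mathbb{C}[\mathbf{x}]$-linear functional on polynomials in umbrae with coefficients in $\mathbb{C}[\mathbf{x}]$ such that $E[\alpha^n]=n![z^n]f(z)$ when $\alpha$ is the umbra of $f$, and $E[\alpha^n\gamma^m\cdots\delta^l]=E[\alpha^n]E[\gamma^m]\cdots E[\delta^l]$ for pairwise distinct umbrae. For an umbral polynomial $\mathbf p$ let $f_{\mathbf p}(z)=E[e^{\mathbf p z}]$. Auxiliary umbrae (treated as further umbrae, uncorrelated with all other distinct umbrae): the dot-product umbra $\mathbf p\boldsymbol{\cdot}\mathbf q$ has $f_{\mathbf p\boldsymbol{\cdot}\mathbf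 q}(z)=f_{\mathbf p}(\log f_{\mathbf q}(z))$. The Bell umbra $\beta$ is the umbra of $e^{e^z-1}$, so $f_{\eta\boldsymbol{\cdot}\beta\boldsymbol{\cdot}\rho}(z)=f_\eta(f_\rho(z)-1)$. The derivative umbra $\alpha_D$ satisfies $f_{\alpha_D}(z)=1+zf_\alpha(z)$. For umbrae $\gamma,\alpha$, the Sheffer sequence of $(\gamma,\alpha)$ is the polynomial sequence $s_n(x)=E[(\gamma+x\boldsymbol{\cdot}\beta\boldsymbol{\cdot}\alpha_D)^n]$, i.e. $\sum_{n\ge0}s_n(x)z^n/n!=f_\gamma(z)\,e^{xzf_\alpha(z)}$; this definition also applies when $\gamma,\alpha$ are auxiliary umbrae such as $\gamma+\eta\boldsymbol{\cdot}\beta\boldsymbol{\cdot}\alpha_D$.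
   Formalization: The moments of γ and α are assumed not to involve x (they may involve the other variables); otherwise the claim fails, e.g. f_γ=e^{xz}, f_α=f_δ=1, f_η=e^z gives (2x+2)^n on the left but (2x+1)^n on the right. *)

(* Defs.v *)
From HB Require Import structures.
From mathcomp Require Import all_boot all_order all_algebra finmap.
From mathcomp Require boolp.
From mathcomp Require Import reals complex.
From mathcomp.multinomials Require Import -(notations) mpoly.
From mathcomp.multinomials Require Import monalg.

Set Implicit Arguments.
Unset Strict Implicit.
Unset Printing Implicit Defensive.

Import GRing.Theory.
Local Open Scope ring_scope.

(* C[x, y_1, ..., y_m] as C[y_1, ..., y_m][x]: the distinguished variable x is
   'X. C is R[i] for an arbitrary model R of the real numbers. *)
Notation Cother R m := (mpoly.mpoly m R[i]).
Notation Cx R m := {poly Cother R m}.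

Section Series.
Variable A : comUnitRingType.

(* A formal power series in z is the sequence of its coefficients. *)
Definition series := nat -> A.

Definition series1 : series := fun n => (n == 0)%:R.

Definition smul (f g : series) : series :=
  fun n => \sum_(i < n.+1) f i * g (n - i)%N.

Definition sexp_n (f : series) (k : nat) : series := iter k (smul f) series1.

(* f(g(z)); only meant for g(0) = 0, where [z^n] g^k = 0 for k > n. *)
Definition scomp (f g : series) : series :=
  fun n => \sum_(k < n.+1) f k * sexp_n g k n.

Definition ssub1 (f : series) : series := fun n => f n - series1 n.

Definition sexp : series := fun n => n`!%:R^-1.

(* log f(z) for f(0) = 1. *)
Definition slog (f : series) : series :=
  scomp (fun k => if k is 0 then 0 else (-1) ^+ k.+1 / k%:R) (ssub1 f).

(* 1 + z f(z) *)
Definition sderiv (f : series) : series := fun n => if n is k.+1 then f k else 1.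

Record useries := USeries { ucoef : series; ucoef0 : ucoef 0 == 1 }.

Fact bell_series0 : scomp sexp (ssub1 sexp) 0 == 1.
Proof.
by rewrite /scomp big_ord_recl big_ord0 addr0 /sexp_n /= /sexp fact0 invr1 mulr1.
Qed.

Definition bell_series := USeries bell_series0.

End Series.

Lemma scale_malgU (A : comUnitRingType) (K : monomType) (c : A) (t : K) :
  c *: << t >> = << c *g t >> :> {malg A[K]}.
Proof.
apply/malgP => t2; rewrite mcoeffZ mcoeffU1 mcoeffU.
by case: (t == t2); rewrite ?mulr0 ?mulr1.
Qed.

Section Umbrae.
Variable A : comUnitRingType.

(* The symbols: one for each series f with f(0) = 1, and the auxiliary symbols
   p . q and p_D. As the type of polynomials cannot be used in an inductive
   definition, the auxiliary symbols carry the list of the terms (coefficient,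
   monomial) of p and q, a monomial being a list of pairs (symbol, exponent);
   see [ucode], [dot] and [uderiv] below. *)
Inductive umbra : Type :=
  | Umbra of useries A
  | DotUmbra of seq (A * seq (umbra * nat)) & seq (A * seq (umbra * nat))
  | DerivUmbra of seq (A * seq (umbra * nat)).

HB.instance Definition _ := boolp.gen_eqMixin umbra.
HB.instance Definition _ := boolp.gen_choiceMixin umbra.

Definition upoly := {malg A[{cmonom umbra}]}.

Definition ucode (p : upoly) : seq (A * seq (umbra * nat)) :=
  [seq (p@_t, [seq (u, t u) | u <- finsupp t]) | t <- msupp p].

Definition udecode (c : seq (A * seq (umbra * nat))) : upoly :=
  \sum_(t <- c) t.1 *: \prod_(v <- t.2) << ucm v.1 >> ^+ v.2.

(* The evaluation, given the generating functions g of the symbols: it sends a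
   monomial u^n v^m ... to (n! [z^n] g u) (m! [z^m] g v) ... *)
Definition eval_with (g : umbra -> series A) : upoly -> A :=
  mmap idfun (fun t : {cmonom umbra} =>
    \prod_(u <- finsupp t) ((t u)`!%:R * g u (t u))).

(* E[e^(p z)] *)
Definition gf_with (g : umbra -> series A) (p : upoly) : series A :=
  fun n => eval_with g (p ^+ n) / n`!%:R.

Fixpoint height (u : umbra) : nat :=
  let hcode c := foldr maxn 0%N [seq foldr maxn 0%N
    [seq (let: (v, _) := w in height v) | w <- (let: (_, t) := b in t)]
    | b <- c] in
  match u with
  | Umbra _ => 0%N
  | DotUmbra p q => (maxn (hcode p) (hcode q)).+1
  | DerivUmbra p => (hcode p).+1
  end.

(* The generating function of a symbol of height at most h; the last branch is
   never reached from [ugf]. *)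
Fixpoint ugf_rec (h : nat) (u : umbra) : series A :=
  match u, h with
  | Umbra f, _ => ucoef f
  | DotUmbra p q, h'.+1 =>
      scomp (gf_with (ugf_rec h') (udecode p))
            (slog (gf_with (ugf_rec h') (udecode q)))
  | DerivUmbra p, h'.+1 => sderiv (gf_with (ugf_rec h') (udecode p))
  | _, 0%N => @series1 A
  end.

Definition ugf (u : umbra) : series A := ugf_rec (height u) u.

(* E is the functional characterized by [E_linear], [E_usym], [E_uncorrelated],
   [ugf_umbra], [ugf_dot] and [ugf_deriv]; the divisions by integers above are
   genuine ones over C[x] by [natr_unit_Cx]. *)
Definition E : upoly -> A := eval_with ugf.

Definition gf : upoly -> series A := gf_with ugf.

Definition usym (u : umbra) : upoly := << ucm u >>.

Definition umb (f : useries A) : upoly := usym (Umbra f).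
Definition dot (p q : upoly) : upoly := usym (DotUmbra (ucode p) (ucode q)).
Definition uderiv (p : upoly) : upoly := usym (DerivUmbra (ucode p)).
Definition bell : upoly := umb (bell_series A).

Lemma umonomM (t1 t2 : {cmonom umbra}) :
  << t1 >> * << t2 >> = << mmul t1 t2 >> :> upoly.
Proof. by have := fgmulUU (1 : A) 1 t1 t2; rewrite [1 * 1]mulr1. Qed.

Lemma usym_exp (u : umbra) k :
  exists t : {cmonom umbra}, usym u ^+ k = << t >> /\
    forall v, t v = if v == u then k else 0%N.
Proof.
elim: k => [|k [t [et ht]]].
  by exists mone; split; rewrite ?expr0 // => v; rewrite cm1 if_same.
exists (mmul (ucm u) t); split; first (rewrite exprS et; exact: umonomM).
by move=> v; rewrite cmM ht cmU eq_sym; case: (v == u); rewrite ?add1n ?add0n.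
Qed.

Lemma umonomial (s : seq umbra) (k : umbra -> nat) : uniq s ->
  exists t : {cmonom umbra}, \prod_(v <- s) usym v ^+ k v = << t >> /\
    forall v, t v = if v \in s then k v else 0%N.
Proof.
elim: s => [_|u s IH /= /andP[us /IH[t [et ht]]]].
  by exists mone; split; rewrite ?big_nil // => v; rewrite cm1.
have [t1 [et1 ht1]] := usym_exp u (k u).
exists (mmul t1 t); split.
  by rewrite big_cons et et1; exact: umonomM.
move=> v; rewrite cmM ht ht1 inE; case: eqP => [->|] /=.
  by rewrite (negPf us) addn0.
by rewrite add0n.
Qed.

Lemma ucodeK : cancel ucode udecode.
Proof.
move=> p; rewrite /udecode /ucode big_map [RHS]monalgE.
apply: eq_bigr => t _ /=; rewrite big_map /=.
have [t' [-> ht]] := umonomial t (fset_uniq (finsupp t)).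
have -> : t' = t.
  by apply/eqP/cmP => v; rewrite ht; case: mdomP.
exact: scale_malgU.
Qed.

Lemma eval_withU g c (t : {cmonom umbra}) :
  eval_with g << c *g t >> = c * \prod_(u <- finsupp t) ((t u)`!%:R * g u (t u)).
Proof. exact: mmapU. Qed.

Lemma eval_with1 g : eval_with g 1 = 1.
Proof. by rewrite [LHS]eval_withU mdom1 big_seq_fset0 mulr1. Qed.

Lemma E_linear c (p q : upoly) : E (c *: p + q) = c * E p + E q.
Proof.
rewrite /E /eval_with mmapD; congr (_ + _).
rewrite (mmapEw (msuppZ_le _ _)) mmapE big_distrr /=.
by apply: eq_bigr => t _; rewrite mcoeffZ mulrA.
Qed.

Lemma E_usym u n : E (usym u ^+ n) = n`!%:R * ugf u n.
Proof.
have [t [-> ht]] := usym_exp u n; rewrite /E eval_withU mul1r.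
case: n ht => [|n] ht.
  have -> : finsupp t = fset0.
    by apply/fsetP => v; rewrite -cmE_neq0 ht if_same.
  rewrite big_seq_fset0 fact0 mul1r /ugf; case: u {ht} => [f|p q|p] //=.
    by rewrite (eqP (ucoef0 f)).
  rewrite /scomp big_ord_recl big_ord0 /= addr0 /gf_with expr0.
  by rewrite eval_with1 fact0 divr1 !mulr1.
have -> : finsupp t = [fset u]%fset.
  by apply/fsetP => v; rewrite -cmE_neq0 ht in_fset1; case: (v == u).
by rewrite big_seq_fset1 ht eqxx.
Qed.

Lemma E_uncorrelated (s : seq umbra) (k : umbra -> nat) : uniq s ->
  E (\prod_(u <- s) usym u ^+ k u) = \prod_(u <- s) E (usym u ^+ k u).
Proof.
move=> us; have [t [-> ht]] := umonomial k us; rewrite {1}/E eval_withU mul1r.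
under [RHS]eq_bigr do rewrite E_usym.
rewrite [RHS](bigID (fun u => u \in finsupp t)) /= [X in _ * X]big_seq_cond.
rewrite [X in _ * X]big1 ?mulr1; last first.
  move=> u /andP[su]; rewrite -cmE_neq0 ht su negbK => /eqP ->.
  by rewrite -E_usym expr0; exact: eval_with1.
rewrite -[RHS]big_filter.
have pe : perm_eq (finsupp t) [seq u <- s | u \in finsupp t].
  apply: uniq_perm; rewrite ?fset_uniq ?filter_uniq // => u.
  rewrite mem_filter -cmE_neq0 ht.
  by case: (u \in s); rewrite ?andbT ?andbF.
rewrite (perm_big _ pe) big_seq [RHS]big_seq; apply: eq_bigr => u.
by rewrite mem_filter ht => /andP[_ ->].
Qed.

Definition usupp_in (P : umbra -> Prop) (p : upoly) :=
  forall t, t \in msupp p -> forall u, u \in finsupp t -> P u.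

Lemma usupp_in_mul P p q : usupp_in P p -> usupp_in P q -> usupp_in P (p * q).
Proof.
move=> hp hq t /msuppM_le [t1 [t2 [h1 h2 ->]]] u.
by rewrite mdomD in_fsetU => /orP[]; [apply: hp|apply: hq].
Qed.

Lemma usupp_in1 P : usupp_in P 1.
Proof. by move=> t; rewrite msuppU1 in_fset1 => /eqP -> u; rewrite mdom1. Qed.

Lemma usupp_inX P p n : usupp_in P p -> usupp_in P (p ^+ n).
Proof.
move=> hp; elim: n => [|n IH]; first by rewrite expr0; apply: usupp_in1.
by rewrite exprS; apply: usupp_in_mul.
Qed.

Lemma usupp_in_decode (P : umbra -> Prop) (c : seq (A * seq (umbra * nat))) :
  (forall b, b \in c -> forall v, v \in b.2 -> P v.1) -> usupp_in P (udecode c).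
Proof.
elim: c => [_|b c IH hc]; rewrite /udecode ?big_nil ?big_cons.
  by move=> t; rewrite msupp0.
move=> t /(fsubsetP (msuppD_le _ _)); rewrite in_fsetU => /orP[]; last first.
  by apply: IH => b' cb'; apply: hc; rewrite inE cb' orbT.
move=> /(fsubsetP (msuppZ_le _ _)); move: t.
have {hc IH} := hc b (mem_head _ _).
elim: b.2 => [_|w l IH hl]; rewrite ?big_nil ?big_cons; first exact: usupp_in1.
apply: usupp_in_mul; last by apply: IH => v lv; apply: hl; rewrite inE lv orbT.
apply: usupp_inX => t; rewrite msuppU1 in_fset1 => /eqP -> u.
by rewrite mdomU in_fset1 => /eqP ->; apply: hl; rewrite mem_head.
Qed.

Lemma eq_gf_with g g' p :
  usupp_in (fun u => g u = g' u) p -> gf_with g p = gf_with g' p.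
Proof.
move=> hp; apply: boolp.funext => n; congr (_ / _).
rewrite /eval_with !mmapE big_seq [RHS]big_seq; apply: eq_bigr => t ht.
congr (_ * _); rewrite big_seq [RHS]big_seq; apply: eq_bigr => u hu.
by rewrite (usupp_inX hp ht hu).
Qed.

Let hcode (c : seq (A * seq (umbra * nat))) := foldr maxn 0%N [seq foldr maxn 0%N
    [seq (let: (v, _) := w in height v) | w <- (let: (_, t) := b in t)] | b <- c].

Let hcode_max (c : seq (A * seq (umbra * nat))) b (v : umbra * nat) : b \in c -> v \in b.2 -> (height v.1 <= hcode c)%N.
Proof.
have le_max (s : seq nat) n : n \in s -> (n <= foldr maxn 0 s)%N.
  elim: s => //= m s IH; rewrite inE => /orP[/eqP ->|/IH]; first exact: leq_maxl.
  by move=> h; rewrite (leq_trans h) // leq_maxr.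
case: b => a l; case: v => v k cb lv; apply: leq_trans (le_max _ _ _); last first.
  by apply/mapP; exists (a, l).
by apply: le_max; apply/mapP; exists (v, k).
Qed.

Lemma ugf_recE h u : (height u <= h)%N -> ugf_rec h u = ugf u.
Proof.
suff gen h1 h2 v : (height v <= h1)%N -> (height v <= h2)%N ->
  ugf_rec h1 v = ugf_rec h2 v by move=> hu; apply: gen.
elim: h1 h2 v => [|h1 IH] [|h2] [f|p q|p] //=; rewrite ?ltnS ?geq_max.
  move=> /andP[p1 q1] /andP[p2 q2].
  congr (scomp _ (slog _)); apply: eq_gf_with; apply: usupp_in_decode => b cb v bv.
    by apply: IH; apply: leq_trans (hcode_max cb bv) _.
  by apply: IH; apply: leq_trans (hcode_max cb bv) _.
move=> p1 p2; congr sderiv; apply: eq_gf_with; apply: usupp_in_decode => b cb v bv.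
by apply: IH; apply: leq_trans (hcode_max cb bv) _.
Qed.

Lemma ugf_umbra f : ugf (Umbra f) = ucoef f.
Proof. by []. Qed.

Let gf_recE h c : (hcode c <= h)%N -> gf_with (ugf_rec h) (udecode c) = gf (udecode c).
Proof.
move=> hc; apply: eq_gf_with; apply: usupp_in_decode => b cb v bv.
by apply: ugf_recE; apply: leq_trans (hcode_max cb bv) _.
Qed.

Lemma ugf_dot p q :
  ugf (DotUmbra (ucode p) (ucode q)) = scomp (gf p) (slog (gf q)).
Proof.
by rewrite /ugf /= !gf_recE ?ucodeK // ?leq_maxl ?leq_maxr.
Qed.

Lemma ugf_deriv p : ugf (DerivUmbra (ucode p)) = sderiv (gf p).
Proof. by rewrite /ugf /= !gf_recE ?ucodeK. Qed.

End Umbrae.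

Notation "p \dot q" := (dot p q) (at level 35, right associativity) : ring_scope.

Section Sheffer.
Variables (R : realType) (m : nat).

Lemma natr_unit_Cx n : n.+1%:R \is a @GRing.unit (Cx R m).
Proof.
have C0 : n.+1%:R \is a @GRing.unit R[i] by rewrite unitfE Num.Theory.pnatr_eq0.
have := rmorph_unit (@polyC (Cother R m)) (rmorph_unit (@mpoly.mpolyC m R[i]) C0).
by rewrite !rmorph_nat.
Qed.

(* (p, q) range over umbral polynomials, so as to cover auxiliary umbrae. *)
Definition sheffer (p q : upoly (Cx R m)) : nat -> Cx R m :=
  fun n => E ((p + 'X%:MP \dot bell _ \dot uderiv q) ^+ n).

Definition umbral_comp (s r : nat -> Cx R m) : nat -> Cx R m :=
  fun n => \sum_(k < n.+1) ((s n)`_k)%:P * r k.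

(* The coefficients s_{n,k} of x^k in s_n(x) are those of f_gamma (z f_alpha)^k
   only if the moments of gamma and alpha do not themselves involve x. *)
Definition free_of_x (f : useries (Cx R m)) : Prop :=
  forall n, exists c : Cother R m, ucoef f n = c%:P.
End Sheffer.

(* Main.v *)
(** Uncorrelated umbrae have multiplicative generating functions, so everything
    reduces to formal power series.  Since [log o exp] is the identity,
    [x . beta . alpha_D] has generating function [exp (x z f_alpha)], hence
    [s_n = n! [z^n] f_gamma exp (x w)] with [w = z f_alpha].  As [gamma] and
    [alpha] do not involve [x], [s_(n,k) = n!/k! [z^n] f_gamma w^k], and the
    umbral composition replaces [x^k / k!] by the [k]-th coefficient of
    [G = f_eta exp (x z f_delta)].  So it has generating function
    [f_gamma (G o w) = f_gamma (f_eta o w) exp (x ((z f_delta) o w))], where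
    [(z f_delta) o w = z (f_alpha (f_delta o w))].  Identities between series
    are proved for polynomials modulo [z^N]; those for [exp] and [log] by
    differentiating. *)
Require Import Defs.
From mathcomp Require Import all_boot all_order all_algebra reals complex finmap.
From mathcomp.multinomials Require Import -(notations) mpoly.
From mathcomp.multinomials Require Import monalg.
From mathcomp Require Import boolp.

Set Implicit Arguments.
Unset Strict Implicit.
Unset Printing Implicit Defensive.

Import GRing.Theory.
Local Open Scope ring_scope.

(** * Power series as polynomials modulo powers of z *)

Section Truncation.
Variable A : comUnitRingType.
Implicit Types (p q : {poly A}) (f g h : series A).

Definition eq_upto N p q := forall i, (i < N)%N -> p`_i = q`_i.

Lemma eq_upto_trans N p q r : eq_upto N p q -> eq_upto N q r -> eq_upto N p r.
Proof. by move=> pq qr i iN; rewrite pq ?qr. Qed.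

Lemma eq_upto_sym N p q : eq_upto N p q -> eq_upto N q p.
Proof. by move=> pq i iN; rewrite pq. Qed.

Lemma eq_uptoM N p p' q q' :
  eq_upto N p p' -> eq_upto N q q' -> eq_upto N (p * q) (p' * q').
Proof.
move=> pp qq i iN; rewrite !coefM; apply: eq_bigr => j _.
by rewrite pp ?qq //; apply: leq_ltn_trans iN; rewrite ?leq_subr // -ltnS.
Qed.

Lemma eq_uptoX N p q k : eq_upto N p q -> eq_upto N (p ^+ k) (q ^+ k).
Proof.
by move=> pq; elim: k => [|k IH]; rewrite ?expr0 // !exprS; apply: eq_uptoM.
Qed.

Lemma coef_exp_lt p k i : p`_0 = 0 -> (i < k)%N -> (p ^+ k)`_i = 0.
Proof.
move=> p0; elim: k i => // k IH i ik; rewrite exprS coefM big_ord_recl p0 mul0r.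
rewrite add0r big1 // => j _; rewrite IH ?mulr0 //.
rewrite lift0; case: i ik j => [|i] ik j; first by case: j.
by rewrite subSS (leq_ltn_trans (leq_subr _ _)).
Qed.

(** The powers [q ^+ k] with k > n start beyond z^n, so the sum over [size p] can be cut or extended
    to the range used by [scomp]. *)
Lemma coef_comp_poly_upto p q n : q`_0 = 0 ->
  (p \Po q)`_n = \sum_(k < n.+1) p`_k * (q ^+ k)`_n.
Proof.
move=> q0; rewrite coef_comp_poly.
have widen := big_ord_widen (maxn (size p) n.+1) (fun k => p`_k * (q ^+ k)`_n).
rewrite widen ?leq_maxl // [RHS]widen ?leq_maxr //.
rewrite big_mkcond [RHS]big_mkcond; apply: eq_bigr => k _.
case: ltnP => ks; case: ltnP => kn //; first by rewrite coef_exp_lt ?mulr0.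
by rewrite nth_default ?mul0r.
Qed.

Lemma eq_upto_comp N p p' q q' : q`_0 = 0 -> q'`_0 = 0 ->
  eq_upto N p p' -> eq_upto N q q' -> eq_upto N (p \Po q) (p' \Po q').
Proof.
move=> q0 q0' pp qq i iN; rewrite !coef_comp_poly_upto //.
apply: eq_bigr => k _; rewrite pp ?(eq_uptoX k qq) //.
by apply: leq_ltn_trans iN; rewrite -ltnS.
Qed.

Definition trunc N f : {poly A} := \poly_(i < N) f i.

Lemma coef_trunc N f i : (i < N)%N -> (trunc N f)`_i = f i.
Proof. by move=> iN; rewrite coef_poly iN. Qed.

Lemma trunc_coef0 N f : f 0 = 0 -> (trunc N f)`_0 = 0.
Proof. by move=> f0; rewrite coef_poly f0 if_same. Qed.

Lemma truncM N f g : eq_upto N (trunc N (smul f g)) (trunc N f * trunc N g).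
Proof.
move=> i iN; rewrite coef_trunc // coefM; apply: eq_bigr => j _.
by rewrite !coef_trunc //; apply: leq_ltn_trans iN; rewrite ?leq_subr // -ltnS.
Qed.

Lemma trunc1 N : eq_upto N (trunc N (@series1 A)) 1.
Proof. by move=> i iN; rewrite coef_trunc // coef1. Qed.

Lemma truncX N f k : eq_upto N (trunc N (sexp_n f k)) (trunc N f ^+ k).
Proof.
elim: k => [|k IH]; first exact: trunc1.
by rewrite exprS; apply: eq_upto_trans (truncM _ _) _; apply: eq_uptoM.
Qed.

Lemma trunc_comp N f g : g 0 = 0 ->
  eq_upto N (trunc N (scomp f g)) (trunc N f \Po trunc N g).
Proof.
move=> g0 i iN; rewrite coef_trunc // coef_comp_poly_upto ?trunc_coef0 //.
apply: eq_bigr => k _; rewrite -(truncX g k iN) !coef_trunc //.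
by apply: leq_ltn_trans iN; rewrite -ltnS.
Qed.

(** Transfer principle: a polynomial identity passes to series once its operations commute with
    [trunc N] below z^N. *)
Lemma series_eqP f g : (forall N, eq_upto N (trunc N f) (trunc N g)) -> f = g.
Proof.
by move=> fg; apply: funext => n; have := fg n.+1 n; rewrite !coef_trunc //; apply.
Qed.

Lemma smulA : associative (@smul A).
Proof.
move=> f g h; apply: series_eqP => N.
apply: eq_upto_trans (truncM _ _) _.
apply: eq_upto_trans (eq_uptoM (fun _ _ => erefl) (truncM _ _)) _.
apply: eq_upto_sym; apply: eq_upto_trans (truncM _ _) _; rewrite mulrA.
exact: (eq_uptoM (truncM _ _) (fun _ _ => erefl)).
Qed.

Lemma smulC : commutative (@smul A).
Proof.
move=> f g; apply: series_eqP => N; apply: eq_upto_trans (truncM _ _) _.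
by apply: eq_upto_sym; rewrite mulrC; apply: truncM.
Qed.

Lemma scomp0 f g : scomp f g 0 = f 0.
Proof. by rewrite /scomp big_ord_recl big_ord0 addr0 mulr1. Qed.

(** Transferred from [comp_polyA]; vanishing constant terms are what lets composition commute with
    truncation. *)
Lemma scompA f g h : g 0 = 0 -> h 0 = 0 ->
  scomp f (scomp g h) = scomp (scomp f g) h.
Proof.
move=> g0 h0; have gh0 : scomp g h 0 = 0 by rewrite scomp0.
apply: series_eqP => N; apply: eq_upto_trans (trunc_comp _ gh0) _.
apply: eq_upto_sym; apply: eq_upto_trans (trunc_comp _ h0) _; apply: eq_upto_sym.
have g0N := trunc_coef0 N g0; have h0N := trunc_coef0 N h0.
have ghN : (trunc N g \Po trunc N h)`_0 = 0.
  by rewrite coef_comp_poly_upto // big_ord_recl big_ord0 addr0 g0N mul0r.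
apply: eq_upto_trans
  (eq_upto_comp (trunc_coef0 N gh0) ghN (fun _ _ => erefl) (trunc_comp _ h0)) _.
rewrite comp_polyA; apply: eq_upto_sym.
exact: eq_upto_comp (trunc_comp _ g0) (fun _ _ => erefl).
Qed.

Lemma scompM f g h : h 0 = 0 ->
  scomp (smul f g) h = smul (scomp f h) (scomp g h).
Proof.
move=> h0; have h0N N := trunc_coef0 N h0.
apply: series_eqP => N; apply: eq_upto_trans (trunc_comp _ h0) _.
apply: eq_upto_trans (eq_upto_comp _ _ (truncM _ _) (fun _ _ => erefl)) _ => //.
rewrite comp_polyM; apply: eq_upto_sym; apply: eq_upto_trans (truncM _ _) _.
by apply: eq_uptoM; apply: trunc_comp.
Qed.

Lemma sexp_n_lt f k n : f 0 = 0 -> (n < k)%N -> sexp_n f k n = 0.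
Proof.
move=> f0 nk; rewrite -(coef_trunc _ (ltnSn n)) (truncX f k (ltnSn n)).
exact: coef_exp_lt (trunc_coef0 _ f0) nk.
Qed.

(** The two sums are exchanged, and the inner range extends from n - i to n because h^k has no terms
    below z^k. With h = z f_alpha this is the source of the coefficients of x^k in s_n. *)
Lemma smul_scomp f g h n : h 0 = 0 ->
  smul f (scomp g h) n = \sum_(k < n.+1) g k * smul f (sexp_n h k) n.
Proof.
move=> h0; rewrite /smul; under [RHS]eq_bigr do rewrite big_distrr.
rewrite exchange_big; apply: eq_bigr => i _; rewrite /scomp.
have le : ((n - i).+1 <= n.+1)%N by rewrite ltnS leq_subr.
rewrite (big_ord_widen n.+1 (fun k => g k * sexp_n h k (n - i)%N) le).
rewrite big_mkcond big_distrr; apply: eq_bigr => k _ /=.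
rewrite mulrCA; case: ltnP => // ik; by rewrite sexp_n_lt ?mulr0.
Qed.

Lemma scompDl f f' g : scomp (fun n => f n + f' n) g =
  (fun n => scomp f g n + scomp f' g n).
Proof.
apply: funext => n; rewrite /scomp -big_split.
by apply: eq_bigr => k _; rewrite mulrDl.
Qed.

Lemma scomp1 g : scomp (@series1 A) g = @series1 A.
Proof.
apply: funext => n; rewrite /scomp big_ord_recl mul1r big1 ?addr0 // => k _.
by rewrite mul0r.
Qed.

Lemma scomp_ssub1 f g : ssub1 (scomp f g) = scomp (ssub1 f) g.
Proof.
apply: funext => n; rewrite /ssub1 -{1}(scomp1 g) /scomp -sumrB.
by apply: eq_bigr => k _; rewrite mulrBl.
Qed.

Definition seriesz : series A := fun n => (n == 1)%:R.

Lemma smul1 f : smul f (@series1 A) = f.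
Proof.
apply: funext => n; rewrite /smul big_ord_recr big1 /= => [|i _].
  by rewrite subnn mulr1 add0r.
by rewrite /series1 subn_eq0 leqNgt ltn_ord mulr0.
Qed.

Lemma scompz g : g 0 = 0 -> scomp seriesz g = g.
Proof.
move=> g0; apply: funext => -[|n]; rewrite ?scomp0 // /scomp.
rewrite !big_ord_recl big1 => [|k _].
  by rewrite mul0r add0r addr0 mul1r /= smul1.
by rewrite mul0r.
Qed.

End Truncation.

(** * The formal exponential and logarithm are inverse to each other *)

Section ExpLog.
Variable A : comUnitRingType.
Hypothesis nat_unit : forall n, n.+1%:R \is a @GRing.unit A.

Lemma fact_unit n : n`!%:R \is a @GRing.unit A.
Proof. by rewrite -(prednK (fact_gt0 n)). Qed.

(** The series log(1 + z), in exactly the form that [slog] contains, so that it can be folded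
    there. *)
Definition log_coef : series A :=
  fun k => if k is 0 then 0 else (-1) ^+ k.+1 / k%:R.

(** Differentiation shifts coefficients down by one, so a derivative correct below z^N takes a
    truncation at [N.+1]. *)
Lemma deriv_trunc_sexp N :
  eq_upto N (trunc N.+1 (@sexp A))^`() (trunc N.+1 (@sexp A)).
Proof.
move=> i iN; rewrite coef_deriv !coef_trunc // 1?ltnW // /sexp factS natrM.
by rewrite invrM ?fact_unit // -[LHS]mulr_natr mulrVK.
Qed.

Lemma deriv_trunc_log N :
  eq_upto N ((trunc N.+1 log_coef)^`() * (1 + 'X)) 1.
Proof.
have cL i : (i < N)%N -> (trunc N.+1 log_coef)^`()`_i = (-1) ^+ i.
  move=> iN; rewrite coef_deriv coef_trunc //= -[LHS]mulr_natr mulrVK //.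
  by rewrite !exprS mulrA mulrNN mul1r mul1r.
move=> [|i] iN; rewrite mulrDr mulr1 coefD coefMX coef1 /= cL ?addr0 //.
by rewrite cL 1?ltnW // exprS mulN1r addNr.
Qed.

(** With L = log(1 + z) and E = e^z - 1, the chain rule gives L'(E) E', where E' = 1 + E. Since (1 +
    z) L' = 1, this derivative is 1; the constant term is 0, which leaves z. *)
Lemma scomp_log_exp : scomp log_coef (ssub1 (@sexp A)) = @seriesz A.
Proof.
have e0 : ssub1 (@sexp A) 0 = 0 by rewrite /ssub1 /sexp invr1 subrr.
apply: funext => -[|n]; first by rewrite scomp0.
have key N : eq_upto N
    (trunc N.+1 log_coef \Po trunc N.+1 (ssub1 (@sexp A)))^`() 1.
  have eE : trunc N.+1 (ssub1 (@sexp A)) = trunc N.+1 (@sexp A) - 1.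
    apply/polyP => i; rewrite coefB coef1 !coef_poly /ssub1 /series1.
    by case: i => [|i] //=; rewrite subr0; case: ifP; rewrite subr0.
  have E0 := trunc_coef0 N.+1 e0.
  rewrite deriv_comp.
  have dE : eq_upto N (trunc N.+1 (ssub1 (@sexp A)))^`()
      ((1 + 'X) \Po trunc N.+1 (ssub1 (@sexp A))).
    rewrite comp_polyD comp_polyX (comp_polyC 1) {2}eE addrC subrK eE.
    by rewrite linearB /= derivC subr0; apply: deriv_trunc_sexp.
  apply: eq_upto_trans (eq_uptoM (fun _ _ => erefl) dE) _.
  rewrite -comp_polyM -[X in eq_upto _ _ X](comp_polyC 1 (trunc N.+1 (ssub1 (@sexp A)))).
  exact: eq_upto_comp (@deriv_trunc_log N) (fun _ _ => erefl).
have := key n.+1 n (ltnSn n); rewrite coef_deriv coef1.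
rewrite -(trunc_comp _ e0) // coef_trunc // -[_ *+ n.+1]mulr_natr => h.
apply: (mulIr (nat_unit n)); rewrite h /seriesz eqSS.
by case: n {h} => [|n]; rewrite ?mulr1 ?mul0r.
Qed.

(** G = exp(log(1 + z)) satisfies (1 + z) G' = G; comparing coefficients gives a recurrence that
    determines G from G(0) = 1. *)
Lemma scomp_exp_log :
  scomp (@sexp A) log_coef = (fun n => series1 A n + seriesz A n).
Proof.
have rec n : scomp (@sexp A) log_coef n.+1 * n.+1%:R
    + scomp (@sexp A) log_coef n * n%:R = scomp (@sexp A) log_coef n.
  pose G := trunc n.+2 (@sexp A) \Po trunc n.+2 log_coef.
  have cG i : (i < n.+2)%N -> G`_i = scomp (@sexp A) log_coef i.
    by move=> iN; rewrite -(trunc_comp _ (erefl : log_coef 0 = 0)) // coef_trunc.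
  have L0 : (trunc n.+2 log_coef)`_0 = 0 by apply: trunc_coef0.
  have dG : eq_upto n.+1 (G^`() * (1 + 'X)) G.
    rewrite deriv_comp -mulrA -[X in eq_upto _ _ X]mulr1.
    apply: eq_uptoM (@deriv_trunc_log _).
    exact: eq_upto_comp (@deriv_trunc_sexp _) (fun _ _ => erefl).
  have := dG n (ltnSn n); rewrite mulrDr mulr1 coefD coefMX !coef_deriv.
  rewrite !cG //; last by case: (n) => // k; rewrite ltnW.
  move=> {2}<-; rewrite mulr_natr; congr (_ + _).
  by case: (n) => [|k]; rewrite ?mulr0 // mulr_natr.
have c0 : scomp (@sexp A) log_coef 0 = 1 by rewrite scomp0 /sexp invr1.
have c1 : scomp (@sexp A) log_coef 1 = 1.
  by have := rec 0; rewrite mulr0 addr0 mulr1 c0.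
apply: funext => -[|[|n]]; rewrite /series1 /seriesz /= ?addr0 ?add0r //.
(* At index 1 the recurrence reads 2 g_2 + g_1 = g_1, so g_2 = 0; from there on each coefficient
   inherits 0 from the previous one. *)
elim: n => [|n IH].
  have := rec 1%N; rewrite c1 mulr1 -[RHS]add0r => /addIr h.
  by apply: (mulIr (nat_unit 1)); rewrite h mul0r.
have := rec n.+2; rewrite IH mul0r addr0 => h.
by apply: (mulIr (nat_unit n.+2)); rewrite h mul0r.
Qed.

Lemma scomp_exp_slog (f : series A) : f 0 = 1 -> scomp (@sexp A) (slog f) = f.
Proof.
move=> f0; have u0 : ssub1 f 0 = 0 by rewrite /ssub1 f0 subrr.
rewrite /slog scompA // scomp_exp_log scompDl scomp1 scompz //.
by apply: funext => n; rewrite /ssub1 addrC subrK.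
Qed.

Lemma slog_scomp_exp (w : series A) : w 0 = 0 -> slog (scomp (@sexp A) w) = w.
Proof.
move=> w0; have e0 : ssub1 (@sexp A) 0 = 0 by rewrite /ssub1 /sexp invr1 subrr.
by rewrite /slog scomp_ssub1 scompA // -/log_coef scomp_log_exp scompz.
Qed.

Lemma slog0 (f : series A) : slog f 0 = 0.
Proof. by rewrite /slog scomp0. Qed.

(** The Bell series is exp(e^z - 1); at z = log f it becomes exp(f - 1), whose logarithm is f -
    1. *)
Lemma slog_bell_slog (f : series A) : f 0 = 1 ->
  slog (scomp (ucoef (bell_series A)) (slog f)) = ssub1 f.
Proof.
move=> f0; have e0 : ssub1 (@sexp A) 0 = 0 by rewrite /ssub1 /sexp invr1 subrr.
rewrite -scompA ?slog0 // -scomp_ssub1 scomp_exp_slog // slog_scomp_exp //.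
by rewrite /ssub1 f0 subrr.
Qed.

End ExpLog.

(** * Generating functions of umbral polynomials *)

Section GeneratingFunctions.
Variable A : comUnitRingType.
Hypothesis nat_unit : forall n, n.+1%:R \is a @GRing.unit A.
Implicit Types (p q : upoly A) (u : umbra A) (P : umbra A -> Prop).

Lemma E_sum (I : Type) (r : seq I) (F : I -> upoly A) :
  E (\sum_(i <- r) F i) = \sum_(i <- r) E (F i).
Proof. exact: raddf_sum. Qed.

Lemma E_monomial c (t : {cmonom umbra A}) :
  E << c *g t >> = c * \prod_(u <- finsupp t) ((t u)`!%:R * ugf u (t u)).
Proof. exact: eval_withU. Qed.

Lemma monomialM (c1 c2 : A) (t1 t2 : {cmonom umbra A}) :
  << c1 *g t1 >> * << c2 *g t2 >> = << c1 * c2 *g mmul t1 t2 >> :> upoly A.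
Proof. exact: fgmulUU. Qed.

(** Each symbol has in the product the exponent it has in the one factor containing it, so the
    product of moments splits. *)
Lemma E_monomialM c1 c2 (t1 t2 : {cmonom umbra A}) :
  [disjoint finsupp t1 & finsupp t2]%fset ->
  E (<< c1 *g t1 >> * << c2 *g t2 >>) = E << c1 *g t1 >> * E << c2 *g t2 >>.
Proof.
move=> dis; apply: etrans (congr1 (@E A) (monomialM c1 c2 t1 t2)) _.
apply: etrans (E_monomial _ _) _.
apply: etrans (esym (congr2 *%R (E_monomial c1 t1) (E_monomial c2 t2))).
rewrite mdomD mulrACA; congr (_ * _).
have pe : perm_eq (finsupp t1 `|` finsupp t2)%fset (finsupp t1 ++ finsupp t2).
  apply: uniq_perm; rewrite ?fset_uniq //.
    rewrite cat_uniq !fset_uniq andbT /=; apply/hasPn => u u2.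
    by apply: contraTN u2 => u1; apply: (fdisjointP dis).
  by move=> u; rewrite in_fsetU mem_cat.
rewrite (perm_big _ pe) big_cat; congr (_ * _); rewrite big_seq [RHS]big_seq.
  apply: eq_bigr => u u1; have := fdisjointP dis _ u1.
  by rewrite -cmE_eq0 cmM => /eqP ->; rewrite addn0.
apply: eq_bigr => u u2; have : u \notin finsupp t1.
  by apply: contraTN u2 => u1; apply: (fdisjointP dis).
by rewrite -cmE_eq0 cmM => /eqP ->.
Qed.

(** [P] separates the symbols of the two factors; bilinearity then reduces to monomials with
    disjoint supports. *)
Lemma E_mul P p q : usupp_in P p -> usupp_in (fun u => ~ P u) q ->
  E (p * q) = E p * E q.
Proof.
move=> hp hq.
have Ep (r : upoly A) : E r = \sum_(t <- msupp r) E << r@_t *g t >>.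
  exact: etrans (congr1 (@E A) (monalgE r)) (E_sum _ _).
have -> : p * q = \sum_(t1 <- msupp p) \sum_(t2 <- msupp q)
    << p@_t1 *g t1 >> * << q@_t2 *g t2 >>.
  by rewrite {1}(monalgE p) {1}(monalgE q) big_distrlr.
apply: etrans (E_sum _ _) _; apply: etrans (esym (congr2 *%R (Ep p) (Ep q))).
rewrite big_distrlr big_seq [RHS]big_seq; apply: eq_bigr => t1 ht1.
apply: etrans (E_sum _ _) _; rewrite big_seq [RHS]big_seq.
apply: eq_bigr => t2 ht2; apply: E_monomialM.
by apply/fdisjointP => u u1; apply/negP => u2; apply: (hq _ ht2 _ u2); apply: hp u1.
Qed.

Lemma E_mulrn p n : E (p *+ n) = E p *+ n.
Proof. exact: raddfMn. Qed.

(** The binomial theorem, with C(n, i) / n! = 1 / (i! (n - i)!). *)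
Lemma gf_add P p q : usupp_in P p -> usupp_in (fun u => ~ P u) q ->
  gf (p + q) = smul (gf p) (gf q).
Proof.
move=> hp hq; apply: funext => n.
(* [exprDn] gives exponent i to the second summand; after [addrC] this is [p], as in the convolution
   [smul]. *)
rewrite /gf /gf_with -/(E _) addrC exprDn E_sum mulr_suml.
apply: eq_bigr => i _; rewrite E_mulrn.
rewrite [q ^+ _ * _]mulrC (E_mul (usupp_inX hp) (usupp_inX hq)).
have ile : (i <= n)%N by rewrite -ltnS.
have Cu : 'C(n, i)%:R \is a @GRing.unit A.
  by rewrite -(prednK (_ : 0 < 'C(n, i))%N) ?bin_gt0.
rewrite -[_ *+ 'C(n, i)]mulr_natr -!mulrA; congr (_ * _); rewrite [RHS]mulrCA.
congr (_ * _); rewrite -(bin_fact ile) !natrM !invrM ?unitrM ?fact_unit //.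
by rewrite mulrCA mulrV // mulr1 mulrC.
Qed.

Lemma gf_usym u : gf (usym u) = ugf u.
Proof.
apply: funext => n; rewrite /gf /gf_with -/(E _) E_usym mulrC mulKr //.
exact: fact_unit.
Qed.

Definition exp_series (c : A) : series A := fun n => c ^+ n / n`!%:R.

Lemma gf_const c : gf (c%:MP : upoly A) = exp_series c.
Proof.
apply: funext => n; rewrite /gf /gf_with -/(E _) -[X in E X]rmorphXn.
by rewrite [E _]E_monomial mdom1 big_seq_fset0 mulr1.
Qed.

Lemma gf_dot p q : gf (p \dot q) = scomp (gf p) (slog (gf q)).
Proof. by rewrite gf_usym ugf_dot. Qed.

Lemma gf_uderiv p : gf (uderiv p) = sderiv (gf p).
Proof. by rewrite gf_usym ugf_deriv. Qed.

Lemma gf_umb (f : useries A) : gf (umb f) = ucoef f.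
Proof. exact: gf_usym. Qed.

Definition zmul (f : series A) : series A := fun n => if n is k.+1 then f k else 0.

Lemma ssub1_sderiv (f : series A) : ssub1 (sderiv f) = zmul f.
Proof. by apply: funext => -[|n]; rewrite /ssub1 /= ?subrr ?subr0. Qed.

(** By [slog_bell_slog] the logarithm of the right operand is the series of [uderiv q] minus 1, that
    is, z times the series of [q]. *)
Lemma gf_dot_bell_uderiv p q :
  gf (p \dot bell A \dot uderiv q) = scomp (gf p) (zmul (gf q)).
Proof.
apply: etrans (gf_dot _ _) (congr1 (scomp (gf p)) _).
apply: etrans (congr1 (@slog A) (gf_dot _ _)) _.
rewrite -ssub1_sderiv -(@slog_bell_slog A) //.
have bellE := gf_umb (bell_series A); have derivE := gf_uderiv q.
exact (congr1 (@slog A) (congr2 (@scomp A) bellE (congr1 (@slog A) derivE))).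
Qed.

Lemma zmul_smul (f g : series A) : zmul (smul f g) = smul (zmul f) g.
Proof.
apply: funext => -[|n]; first by rewrite /smul big_ord_recl big_ord0 mul0r addr0.
by rewrite [RHS]big_ord_recl mul0r add0r.
Qed.

Lemma zmulE f : zmul f = smul (seriesz A) f.
Proof.
have <- : zmul (@series1 A) = seriesz A by apply: funext => -[|[|n]].
by rewrite -zmul_smul smulC smul1.
Qed.

Lemma scomp_zmul (f w : series A) : w 0 = 0 ->
  scomp (zmul f) w = smul w (scomp f w).
Proof. by move=> w0; rewrite zmulE scompM // scompz. Qed.

Lemma usupp_in_usym P u : P u -> usupp_in P (usym u).
Proof.
by move=> Pu t; rewrite msuppU1 in_fset1 => /eqP -> v; rewrite mdomU in_fset1 => /eqP ->.
Qed.

Lemma usupp_in_add P p q : usupp_in P p -> usupp_in P q -> usupp_in P (p + q).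
Proof.
by move=> hp hq t /(fsubsetP (msuppD_le _ _)); rewrite in_fsetU => /orP[/hp|/hq].
Qed.

(** Tells auxiliary symbols apart, hence makes them uncorrelated; it rests on the injectivity of
    [ucode]. *)
Lemma dot_usym_neq p p' q q' : p != p' ->
  DotUmbra (ucode p) (ucode q) <> DotUmbra (ucode p') (ucode q').
Proof. by move=> /eqP pp [/(can_inj (@ucodeK A))]. Qed.

(** The coefficients at the monomial of the symbol differ: 1 against 0. *)
Lemma umb_neq_const (f : useries A) c : umb f != c%:MP.
Proof.
apply/eqP => h; pose t := ucm (Umbra f).
have : 1 = (c%:MP : upoly A)@_t by rewrite -h; exact: (esym (mcoeffUU t 1)).
by rewrite mcoeffC cm1_eq1 mulr0n => /eqP; rewrite oner_eq0.
Qed.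

Lemma E_exp p n : E (p ^+ n) = n`!%:R * gf p n.
Proof. by rewrite /gf /gf_with mulrC divrK // fact_unit. Qed.

(** The dot product is a single symbol; the second hypothesis keeps it out of [p], so that [gf_add]
    applies. *)
Lemma gf_add_dot P p c q : usupp_in P p ->
  ~ P (DotUmbra (ucode c%:MP) (ucode (bell A \dot uderiv q))) ->
  gf (p + c%:MP \dot bell A \dot uderiv q) =
  smul (gf p) (scomp (exp_series c) (zmul (gf q))).
Proof.
move=> hp hq; rewrite -gf_const -gf_dot_bell_uderiv.
exact: gf_add hp (usupp_in_usym hq).
Qed.

Lemma gf_umb_add_dot (f g h : useries A) :
  gf (umb f + umb g \dot bell A \dot uderiv (umb h)) =
  smul (ucoef f) (scomp (ucoef g) (zmul (ucoef h))).
Proof.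
rewrite -(gf_umb f) -(gf_umb g) -(gf_umb h) -gf_dot_bell_uderiv.
by apply: (@gf_add (fun u => u = Umbra f)); apply: usupp_in_usym.
Qed.

End GeneratingFunctions.

(** * Sheffer sequences *)

Section ShefferGF.
Variables (R : realType) (m : nat).
Notation A := (Cx R m).
Implicit Types (f g : useries A) (p q : upoly A).

Let nat_unit := @natr_unit_Cx R m.

Notation exp_xz := (exp_series ('X : A)).

Lemma sheffer_gf (P : umbra A -> Prop) p q : usupp_in P p ->
  ~ P (DotUmbra (ucode 'X%:MP) (ucode (bell A \dot uderiv q))) ->
  forall n, sheffer p q n = n`!%:R * smul (gf p) (scomp exp_xz (zmul (gf q))) n.
Proof.
move=> hp hq n; apply: etrans (E_exp nat_unit _ _) _.
exact: (congr1 (fun f : series A => n`!%:R * f n) (gf_add_dot nat_unit hp hq)).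
Qed.

Lemma sheffer_umb f g n : sheffer (umb f) (umb g) n =
  n`!%:R * smul (ucoef f) (scomp exp_xz (zmul (ucoef g))) n.
Proof.
rewrite -(gf_umb nat_unit f) -(gf_umb nat_unit g).
by apply: (@sheffer_gf (fun u => u = Umbra f)) => //; apply: usupp_in_usym.
Qed.

Lemma sheffer_umb_add_dot f g f' g' h n :
  sheffer (umb f + umb g \dot bell A \dot uderiv (umb h))
          (umb f' + umb g' \dot bell A \dot uderiv (umb h)) n =
  n`!%:R * smul (smul (ucoef f) (scomp (ucoef g) (zmul (ucoef h))))
    (scomp exp_xz (zmul (smul (ucoef f') (scomp (ucoef g') (zmul (ucoef h)))))) n.
Proof.
pose P u := u = Umbra f \/
  u = DotUmbra (ucode (umb g)) (ucode (bell A \dot uderiv (umb h))).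
have hp : usupp_in P (umb f + umb g \dot bell A \dot uderiv (umb h)).
  by apply: usupp_in_add; apply: usupp_in_usym; [left|right].
apply: etrans (sheffer_gf hp _ n) _.
  (* The symbol starting with x is not an ordinary umbra, and its left operand is a constant rather
     than [umb g]. *)
  by case=> [//|/esym]; exact: dot_usym_neq (umb_neq_const _ _).
exact: (congr2 (fun u v : series A => n`!%:R * smul u (scomp exp_xz (zmul v)) n)
  (gf_umb_add_dot nat_unit f g h) (gf_umb_add_dot nat_unit f' g' h)).
Qed.

(** The analogue of [free_of_x] for bare series, so as to cover the powers of z f_alpha, whose
    constant term need not be 1. *)
Definition constant_series (f : series A) := forall n, exists c, f n = c%:P.

Lemma constant_smul (f g : series A) :
  constant_series f -> constant_series g -> constant_series (smul f g).
Proof.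
move=> /choice[a fa] /choice[b gb] n.
exists (\sum_(i < n.+1) a i * b (n - i)%N).
by rewrite rmorph_sum; apply: eq_bigr => i _; rewrite /= fa gb rmorphM.
Qed.

Lemma constant_sexp_n (f : series A) k :
  constant_series f -> constant_series (sexp_n f k).
Proof.
move=> cf; elim: k => [|k IH]; last exact: constant_smul.
by move=> n; exists (n == 0)%:R; rewrite rmorph_nat.
Qed.

Lemma constant_zmul (f : series A) : constant_series f -> constant_series (zmul f).
Proof. by move=> cf [|n]; [exists 0; rewrite polyC0|apply: cf]. Qed.

(** Expanding exp(x w) displays s_n as a sum of powers of x with factors free of x, which must then
    be its coefficients. Keeping k! on the left avoids a division. *)
Lemma coef_sheffer_umb f g n k : free_of_x f -> free_of_x g -> (k <= n)%N ->
  ((sheffer (umb f) (umb g) n)`_k)%:P * k`!%:R =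
  n`!%:R * smul (ucoef f) (sexp_n (zmul (ucoef g)) k) n :> A.
Proof.
move=> cf cg kn; rewrite sheffer_umb smul_scomp // big_distrr /=.
have /choice[c hc] i := constant_smul cf (constant_sexp_n i (constant_zmul cg)) n.
(* n!/i! is an integer for i <= n, so this coefficient lies in [Cother R m] without any inverse. *)
pose d i := (n`! %/ i`!)%:R * c i.
have -> : \sum_(i < n.+1) n`!%:R *
    (exp_xz i * smul (ucoef f) (sexp_n (zmul (ucoef g)) i) n) =
    \poly_(i < n.+1) d i.
  rewrite poly_def; apply: eq_bigr => i _; rewrite hc /exp_xz -mul_polyC /d.
  have dvd : (i`! %| n`!)%N.
    have ile : (i <= n)%N by rewrite -ltnS.
    by rewrite -(bin_fact ile) mulnCA dvdn_mulr.
  rewrite polyCM rmorph_nat -{1}(divnK dvd) natrM.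
  rewrite -!mulrA; congr (_ * _).
  by rewrite mulrCA mulVKr ?fact_unit // mulrC.
rewrite coef_poly ltnS kn /d hc polyCM rmorph_nat mulrAC -natrM divnK //.
by rewrite -(bin_fact kn) mulnCA dvdn_mulr.
Qed.

End ShefferGF.

Theorem mainTheorem8 (R : realType) (m : nat)
    (gamma alpha eta delta : useries (Cx R m))
    (hgamma : free_of_x gamma) (halpha : free_of_x alpha) :
  let s := sheffer (umb gamma) (umb alpha) in
  let r := sheffer (umb eta) (umb delta) in
  forall n : nat,
    umbral_comp s r n =
    sheffer (umb gamma + umb eta \dot bell _ \dot uderiv (umb alpha))
            (umb alpha + umb delta \dot bell _ \dot uderiv (umb alpha)) n.
Proof.
move=> s r n; apply: etrans (esym (sheffer_umb_add_dot gamma eta alpha delta alpha n)).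
set w := zmul (ucoef alpha); have w0 : w 0 = 0 by [].
have -> : zmul (smul (ucoef alpha) (scomp (ucoef delta) w)) =
    scomp (zmul (ucoef delta)) w by rewrite zmul_smul scomp_zmul.
(* Both factors composed with [w] merge into a single series G composed with [w], which is then
   expanded in powers of [w]. *)
rewrite scompA // -smulA -scompM // smul_scomp // big_distrr.
(* Since r_k = k! G_k, its factorial is the one that [coef_sheffer_umb] attaches to s_(n,k). *)
apply: eq_bigr => k _; rewrite /r sheffer_umb mulrA.
rewrite coef_sheffer_umb //; last by rewrite -ltnS.
by rewrite -mulrA; congr (_ * _); rewrite mulrC.
Qed.
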